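(* Let $\vartheta>0$, let $\hat g\in\hat{\mathscr{G}}$ be an arbitrary distributed delay, of the form of a finite sum $$\hat g(s)=\sum_{i,k}\hat g_{ik}(e^{-\vartheta s})\,\hat\theta_{\lambda_i}^{(k)}(s),$$ with $\lambda_i\in\mathbb{C}$, $k\in\mathbb{N}$, and $\hat g_{ik}(e^{-\vartheta s})\in\mathbb{C}[e^{-\vartheta s}]$ complex polynomials in $e^{-\vartheta s}$, and let $\varepsilon_i$ be given positive real numbers. For any elements $\psi_{\lambda_i,n}\in\mathscr{K}_s([0,\vartheta])\cap\mathscr{B}(\theta_{\lambda_i},\varepsilon_i)$, define $$\hat g_{\mathrm{app}}(s)=\sum_{i,k}\hat g_{ik}(e^{-\vartheta s})\,\hat\psi_{\lambda_i,n}^{(k)}(s).$$ Then $g_{\mathrm{app}}$ lies in $\mathscr{K}_s([0,\vartheta])\cap\mathscr{B}(g,\tilde\varepsilon)$, where $\tilde\varepsilon=M\cdot\max_i\varepsilon_i$ for some positive constant $M$.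
   Context: $\mathscr{A}$ is the set of distributions supported on $[0,\infty)$ of the form $f=f_a+\sum_{n\ge 0}f_n\delta(t-t_n)$, with $f_a\in\mathscr{L}_1(\mathbb{R}_+)$ complex valued, $f_n\in\mathbb{C}$, $0=t_0<t_1<\dots$, $\sum_n|f_n|<\infty$, and $\delta(t-t_n)$ the Dirac distribution at $t_n$. It is a commutative Banach algebra under convolution with norm $\|f\|_{\mathscr{A}}=\|f_a\|_{\mathscr{L}_1}+\sum_{n}|f_n|$. For $p\in\mathscr{A}$ and $r>0$, $\mathscr{B}(p,r)=\{q\in\mathscr{A}:\|p-q\|_{\mathscr{A}}\le r\}$. The hat denotes the Laplace transform, and the superscript $(k)$ denotes the $k$th derivative with respect to $s$. For a bounded closed interval $I\subset[0,\infty)$, $\mathscr{K}(I)$ is the set of functions that vanish outside $I$ and equal on $I$ a finite sum $\sum_{i,j\geq 0}c_{ij}t^je^{\lambda_i t}$ with $c_{ij},\lambda_i\in\mathbb{C}$; $\mathscr{K}_s(I)$ is the subset of those with all $\mathrm{Re}\,\lambda_i<0$. A distributed delay is a causal convolution operator with kernel in $\mathscr{K}([\vartheta_1,\vartheta_2])$ for some reals $0\le\vartheta_1<\vartheta_2$; $\mathscr{G}$ is the set of distributed delays (identified with their kernels) and $\hat{\mathscr{G}}$ the set of their Laplace transforms; $g$ and $g_{\mathrm{app}}$ are the kernels with Laplace transforms $\hat g$ and $\hat g_{\mathrm{app}}$. For $\lambda\in\mathbb{C}$, $\theta_\lambda(t)=e^{\lambda t}$ for $t\in[0,\vartheta]$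 and $0$ elsewhere, so $\hat\theta_\lambda(s)=\frac{1-e^{-(s-\lambda)\vartheta}}{s-\lambda}$, and $\hat\theta_\lambda^{(k)}$ is the Laplace transform of the function equal to $(-t)^ke^{\lambda t}$ on $[0,\vartheta]$ and $0$ elsewhere. In the symbol $\psi_{\lambda_i,n}$ the subscripts are just labels (one function for each $i$).
   Formalization: Membership of g_app in K_s([0,ϑ]) fails for non-constant ĝ_ik (e.g. ĝ = e^{-ϑs}θ̂_λ); it is stated only for constant ĝ_ik. In general g_app is a sum of translates by nϑ, n up to the degree bound, of elements of K_s([0,ϑ]). The ball bound is in full. *)

(* Defs.v *)
(* MathComp-Analysis; the reals are an arbitrary [R : realType], the complex
   numbers are [R[i]] from mathcomp-real-closed. *)
From HB Require Import structures.
From mathcomp Require Import all_boot all_order all_algebra.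
From mathcomp Require Import complex.
From mathcomp Require Import all_classical all_reals all_analysis.

Set Implicit Arguments.
Unset Strict Implicit.
Unset Printing Implicit Defensive.

Import Order.TTheory GRing.Theory Num.Theory.
Import numFieldNormedType.Exports.

Local Open Scope classical_set_scope.
Local Open Scope ring_scope.
Local Open Scope complex_scope.

Section Complex.
Context {R : realType}.
Implicit Types (z s : R[i]) (f : R -> R[i]).

(* The norm [`|z|] of [R[i]] is itself an element of [R[i]]. *)
Definition modulus z : R := complex.Re `|z|.

Definition cexp z : R[i] :=
  (expR (complex.Re z))%:C * (cos (complex.Im z) +i* sin (complex.Im z)).

Definition cintegrable (D : set R) f : Prop :=
  lebesgue_measure.-integrable D (fun t => (complex.Re (f t))%:E) /\
  lebesgue_measure.-integrable D (fun t => (complex.Im (f t))%:E).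

Definition cintegral (D : set R) f : R[i] :=
  (\int[lebesgue_measure]_(t in D) complex.Re (f t)) +i*
  (\int[lebesgue_measure]_(t in D) complex.Im (f t)).

Definition laplace f s : R[i] :=
  cintegral `[0, +oo[ (fun t => f t * cexp (- (s * t%:C))).

End Complex.

(* Stated for an abstract field so that the topology is the one induced by the
   norm; used at [C := R[i]], where it is the [k]-th complex derivative. *)
Definition cderiven (C : numFieldType) (k : nat) (F : C -> C) : C -> C :=
  derive1n k F.

Section Algebra.
Context {R : realType}.

(* The distribution [f_a + sum_n f_n delta(t - t_n)]; the atomic part is
   encoded by the function mapping [t_n] to [f_n] and every other point to
   [0]. Two distributions are equal when the norm of their difference is 0. *)
Record distribution := Distribution {
  regular_part : R -> R[i] ;
  atomic_part : R -> R[i] }.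

Definition distribution_sub (p q : distribution) : distribution :=
  Distribution (fun t => regular_part p t - regular_part q t)
               (fun t => atomic_part p t - atomic_part q t).

Definition normA (p : distribution) : \bar R :=
  (\int[lebesgue_measure]_(t in setT) (modulus (regular_part p t))%:E +
   \esum_(t in setT) (modulus (atomic_part p t))%:E)%E.

Definition L1_halfline (f : R -> R[i]) : Prop :=
  (forall t, t < 0 -> f t = 0) /\ cintegrable setT f.

Definition algebraA : set distribution := [set p |
  [/\ L1_halfline (regular_part p),
      exists t_ : nat -> R, [/\ t_ 0%N = 0,
        (forall n, t_ n < t_ n.+1) &
        (forall t, ~ range t_ t -> atomic_part p t = 0)] &
      (\esum_(t in setT) (modulus (atomic_part p t))%:E < +oo)%E]].

Definition ballA (p : distribution) (r : R) : set distribution :=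
  [set q | algebraA q /\ (normA (distribution_sub p q) <= r%:E)%E].

Definition of_kernel (f : R -> R[i]) : distribution :=
  Distribution f (fun=> 0).

(* [f] is a kernel (an element of L^1(R_+)) with Laplace transform [F] on the
   closed right half-plane. *)
Definition has_laplace (f : R -> R[i]) (F : R[i] -> R[i]) : Prop :=
  L1_halfline f /\ forall s, 0 <= complex.Re s -> laplace f s = F s.

End Algebra.

Section Kernels.
Context {R : realType}.
Implicit Types (a b : R) (f : R -> R[i]).

Definition exp_poly (m n : nat) (c : 'I_m -> 'I_n -> R[i])
    (lambda : 'I_m -> R[i]) (t : R) : R[i] :=
  \sum_(i < m) \sum_(j < n) c i j * t%:C ^+ j * cexp (lambda i * t%:C).

Definition exp_kernels (S : set R[i]) a b : set (R -> R[i]) := [set f |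
  (forall t, t \notin `[a, b] -> f t = 0) /\
  exists m n (c : 'I_m -> 'I_n -> R[i]) (lambda : 'I_m -> R[i]),
    (forall i, S (lambda i)) /\
    forall t, t \in `[a, b] -> f t = exp_poly c lambda t].

Definition kernels a b := exp_kernels setT a b.

Definition stable_kernels a b :=
  exp_kernels [set z | complex.Re z < 0] a b.

Definition distributed_delays : set (R -> R[i]) := [set f |
  exists a b, [/\ 0 <= a, a < b & kernels a b f]].

Definition theta (vartheta : R) (lambda : R[i]) (t : R) : R[i] :=
  if t \in `[0, vartheta] then cexp (lambda * t%:C) else 0.

(* Sums of the translates by [0, vartheta, ..., N * vartheta] of elements of
   [stable_kernels 0 vartheta]: multiplication of a Laplace transform by
   [exp(- n vartheta s)] translates the kernel by [n * vartheta], hence outside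
   [[0, vartheta]] as soon as [0 < n]. For [N = 0] this is
   [stable_kernels 0 vartheta]. *)
Definition delayed_stable_kernels (vartheta : R) (N : nat) :
    set (R -> R[i]) := [set f |
  exists h : nat -> R -> R[i], (forall n, stable_kernels 0 vartheta (h n)) /\
    forall t, f t = \sum_(n < N.+1) h n (t - n%:R * vartheta)].

(* Kernels are elements of L^1, that is, functions up to a null set. *)
Definition ae_member (S : set (R -> R[i])) f : Prop :=
  exists2 h, S h & {ae lebesgue_measure, forall t, f t = h t}.

(* sum_{i,k} g_ik(exp(- vartheta s)) F_i^(k)(s) *)
Definition delay_combination (vartheta : R) (m n : nat)
    (G : 'I_m -> 'I_n -> {poly R[i]}) (F : 'I_m -> R[i] -> R[i])
    (s : R[i]) : R[i] :=
  \sum_(i < m) \sum_(k < n)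
    (G i k).[cexp (- (vartheta%:C * s))] * cderiven k (F i) s.

End Kernels.

(* Main.v *)
Require Import Defs.
From HB Require Import structures.
From mathcomp Require Import all_boot all_order all_algebra.
From mathcomp Require Import complex.
From mathcomp Require Import all_classical all_reals all_analysis.
From mathcomp Require Import measurable_realfun ring lra.
Import Order.TTheory GRing.Theory Num.Theory.
Import numFieldNormedType.Exports.
Local Open Scope classical_set_scope.
Local Open Scope ring_scope.
Local Open Scope complex_scope.

(** Differentiating under the integral sign, the [k]-th derivative of the
    transform of a bounded kernel [f] supported in [[0, vartheta]] is the
    transform of [(- t)^k f(t)], and multiplication by [exp(- n vartheta s)]
    translates the kernel by [n vartheta]. Hence [delay_combination] is the
    transform of an explicit kernel, linear in the family of [F i], whose L^1
    norm is at most [sum |g_ikn| vartheta^k ||F i||_1]. By injectivity of the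
    Laplace transform, [g] and [g_app] agree almost everywhere with these
    explicit kernels, and the bound is applied to [theta_i - psi_i].

    Injectivity: with [u = exp(- sigma t)], the functions
    [(1 - u^n)^(2^n)] are polynomials in [u] converging boundedly to the
    indicator of [u < 1/2], i.e. of [t > ln 2 / sigma]; so a function with zero
    transform has zero integral over every tail [(a, oo)], hence is zero almost
    everywhere by Lebesgue differentiation. *)

(** * Powers converging to a step function *)

(** Bernoulli's inequality with exponent [2 ^ n] gives the lower bound [1 - (2 * x) ^+ n], which
    tends to 1 because [2 * x < 1]. *)
Lemma pow_step_cvg1 (R : realType) (x : R) : 0 <= x -> x < 2^-1 ->
  (1 - x ^+ n) ^+ (2 ^ n) @[n --> \oo] --> (1 : R).
Proof.
move=> x0 x2; have x1 : x <= 1 by lra.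
apply: (@squeeze_cvgr _ _ _ _ (fun n => 1 - (2 * x) ^+ n) (fun=> 1)).
- apply: nearW => n.
  have xn1 : x ^+ n <= 1 by rewrite exprn_ile1.
  have xn0 : 0 <= x ^+ n by rewrite exprn_ge0.
  apply/andP; split; last by rewrite exprn_ile1 ?subr_ge0// lerBlDr lerDl.
  have B : forall N : nat, 1 - N%:R * x ^+ n <= (1 - x ^+ n) ^+ N.
    elim=> [|N IH]; first by rewrite mul0r subr0 expr0.
    rewrite exprS (le_trans _ (ler_wpM2l _ IH)) ?subr_ge0//.
    rewrite -subr_ge0 [leRHS](_ : _ = N%:R * x ^+ n ^+ 2); last by ring.
    by rewrite mulr_ge0// sqr_ge0.
  by rewrite exprMn -natrX.
- rewrite -[X in _ --> X]subr0; apply: cvgB; first exact: cvg_cst.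
  by apply: cvg_expr; rewrite ger0_norm; lra.
- exact: cvg_cst.
Qed.

(** From [(1 - y)^N (1 + N y) <= 1] with [y = x^n] and [N = 2^n], the power is at most
    [1 / (2 x)^n], which tends to 0 because [2 x > 1]. *)
Lemma pow_step_cvg0 (R : realType) (x : R) : 2^-1 < x -> x <= 1 ->
  (1 - x ^+ n) ^+ (2 ^ n) @[n --> \oo] --> (0 : R).
Proof.
move=> x2 x1; have x0 : 0 < x by lra.
apply: (@squeeze_cvgr _ _ _ _ (fun=> 0) (fun n => ((2 * x)^-1) ^+ n)).
- apply: nearW => n.
  have xn1 : x ^+ n <= 1 by rewrite exprn_ile1// ltW.
  have xn0 : 0 < x ^+ n by rewrite exprn_gt0.
  apply/andP; split; first by rewrite exprn_ge0 ?subr_ge0.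
  have B : forall N : nat, (1 - x ^+ n) ^+ N * (1 + N%:R * x ^+ n) <= 1.
    elim=> [|N IH]; first by rewrite mul0r addr0 expr0 mul1r.
    have y0 : 0 <= (1 - x ^+ n) ^+ N by rewrite exprn_ge0 ?subr_ge0.
    apply: le_trans IH; rewrite exprSr -mulrA ler_wpM2l//.
    rewrite -subr_ge0 [leRHS](_ : _ = N.+1%:R * x ^+ n ^+ 2); last by ring.
    by rewrite mulr_ge0// sqr_ge0.
  rewrite exprVn exprMn -natrX -[leRHS]mul1r ler_pdivlMr; last first.
    by rewrite mulr_gt0// natrX exprn_gt0.
  apply: le_trans (B (2 ^ n)%N); rewrite ler_wpM2l ?lerDr//.
  by rewrite exprn_ge0 ?subr_ge0.
- exact: cvg_cst.
- apply: cvg_expr; rewrite ger0_norm ?invr_ge0; last by lra.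
  by rewrite invf_lt1; lra.
Qed.

(** * Injectivity of the Laplace transform on real integrable functions *)

Section real_uniqueness.
Context {R : realType}.
Notation mu := (@lebesgue_measure R).
Local Open Scope ereal_scope.

Lemma integrable_mul_bounded (D : set R) (f h : R -> R) (B : R) :
  measurable D -> mu.-integrable D (EFin \o f) -> measurable_fun D h ->
  (forall t, D t -> `|h t| <= B)%R ->
  mu.-integrable D (fun t => (f t * h t)%:E).
Proof.
move=> mD fi mh hB.
have mf : measurable_fun D f by apply/measurable_EFinP;
  apply: measurable_int fi.
have Bi : mu.-integrable D (fun t => B%:E * (EFin \o f) t)
  by exact: integrableZl.
apply: le_integrable Bi => //.
  by apply/measurable_EFinP; exact: measurable_funM.
move=> t Dt /=; rewrite !lee_fin !normrM mulrC ler_wpM2r//.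
by rewrite (le_trans (hB _ Dt))// ler_norm.
Qed.

(** Induction on [N]: with [u = exp(- sigma t)], expanding one factor [1 - u^k] leaves the exponents
    [j] and [j + k] and one factor fewer, so [j] stays general. For [N = 0] the integral is the
    transform at [s = j sigma]. *)
Lemma integral_mul_pow_sub1 (f : R -> R) (sigma : R) (k : nat) :
  (0 <= sigma)%R -> mu.-integrable `[0%R, +oo[ (EFin \o f) ->
  (forall s : R, (0 <= s)%R ->
    \int[mu]_(t in `[0%R, +oo[) (f t * expR (- (s * t)))%:E = 0) ->
  forall N j, \int[mu]_(t in `[0%R, +oo[)
    (f t * (expR (- (sigma * t)) ^+ j *
      (1 - expR (- (sigma * t)) ^+ k) ^+ N))%:E = 0.
Proof.
move=> s0 fi f0.
pose u t := expR (- (sigma * t)).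
have u01 (t : R) : `[0%R, +oo[%classic t -> (0 <= u t <= 1)%R.
  rewrite /= in_itv/= andbT => t0.
  by rewrite expR_ge0 expR_le1 oppr_le0 mulr_ge0.
have mu' : measurable_fun (`[0%R, +oo[ : set R) u.
  by do 2 apply: measurableT_comp => //.
elim=> [|N IH] j.
  rewrite -[RHS](f0 (j%:R * sigma)%R); last by rewrite mulr_ge0.
  by apply: eq_integral => t _; rewrite expr0 mulr1 -expRM_natl mulrN mulrA.
transitivity (\int[mu]_(t in `[0%R, +oo[)
  ((f t * (u t ^+ j * (1 - u t ^+ k) ^+ N))%:E -
   (f t * (u t ^+ (j + k) * (1 - u t ^+ k) ^+ N))%:E)).
  apply: eq_integral => t _; rewrite -EFinB /u; congr EFin.
  rewrite exprS exprD; ring.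
have int j' : mu.-integrable `[0%R, +oo[
    (fun t => (f t * (u t ^+ j' * (1 - u t ^+ k) ^+ N))%:E).
  apply: (@integrable_mul_bounded _ _ _ 1) => //.
    apply: measurable_funM; apply: measurable_funX => //.
    by apply: measurable_funB => //; exact: measurable_funX.
  move=> t /u01/andP[u0 u1].
  have uk0 : (0 <= u t ^+ k)%R by rewrite exprn_ge0.
  have uk1 : (u t ^+ k <= 1)%R by rewrite exprn_ile1.
  rewrite ger0_norm ?mulr_ge0 ?exprn_ge0 ?subr_ge0//.
  by rewrite mulr_ile1 ?exprn_ge0 ?exprn_ile1 ?subr_ge0// lerBlDr lerDl.
by rewrite integralB// !IH subee.
Qed.

(** The integrals of [f] against [(1 - u^n)^(2^n)] are all 0 and converge to the tail integral by
    dominated convergence, with [|f|] as majorant. *)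
Lemma integral_tail_eq0 (f : R -> R) (a : R) : (0 < a)%R ->
  mu.-integrable `[0%R, +oo[ (EFin \o f) ->
  (forall s : R, (0 <= s)%R ->
    \int[mu]_(t in `[0%R, +oo[) (f t * expR (- (s * t)))%:E = 0) ->
  \int[mu]_(t in `]a, +oo[) (f t)%:E = 0.
Proof.
(* This rate makes [u a = 1/2], so the limiting step function jumps exactly at [a]. *)
move=> a0 fi f0; pose sigma := (ln 2 / a)%R.
have s0 : (0 < sigma)%R by rewrite divr_gt0// ln_gt0// ltr1n.
pose u t := expR (- (sigma * t)).
have u01 (t : R) : `[0%R, +oo[%classic t -> (0 <= u t <= 1)%R.
  rewrite /= in_itv/= andbT => t0.
  by rewrite expR_ge0 expR_le1 oppr_le0 mulr_ge0// ltW.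
have ua : u a = 2^-1%R.
  by rewrite /u /sigma divfK ?gt_eqF// expRN lnK// posrE.
have mf : measurable_fun (`[0%R, +oo[ : set R) f.
  by apply/measurable_EFinP; apply: measurable_int fi.
have mu' : measurable_fun (`[0%R, +oo[ : set R) u.
  apply: measurableT_comp => //; exact: measurableT_comp.
pose f_ n t := (f t * ((u t) ^+ 0 * (1 - u t ^+ n) ^+ (2 ^ n)))%:E.
pose g t := (f t * \1_`]a, +oo[ t)%:E.
have [] := @dominated_convergence _ _ R mu `[0%R, +oo[ _ f_ g
   (abse \o (EFin \o f)).
- by [].
- move=> n; apply/measurable_EFinP; apply: measurable_funM => //.
  apply: measurable_funM; apply: measurable_funX => //.
  by apply: measurable_funB => //; exact: measurable_funX.
- by apply/measurable_EFinP; apply: measurable_funM.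
(* At [t = a], where [u t = 1/2], neither convergence lemma applies; a single point is null. *)
- exists [set a]; split => //; first exact: lebesgue_measure_set1.
  move=> t /=; apply: contra_notP => /eqP ta D0.
  have /andP[u0 u1] := u01 _ D0.
  have L : (fun n => (u t) ^+ 0 * (1 - u t ^+ n) ^+ (2 ^ n))%R @ \oo -->
      (\1_`]a, +oo[ t : R).
    under eq_fun do rewrite expr0 mul1r.
    have [ta'|ta'|/eqP] := ltgtP t a; last by rewrite (negbTE ta).
    - rewrite indicE memNset; last first.
        by rewrite /= in_itv/= andbT; apply/negP; rewrite -leNgt ltW.
      apply: pow_step_cvg0 => //.
      by rewrite -ua ltr_expR ltrN2 ltr_pM2l.
    - rewrite indicE mem_set; last by rewrite /= in_itv/= andbT.
      apply: pow_step_cvg1 => //.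
      by rewrite -ua ltr_expR ltrN2 ltr_pM2l.
  apply: cvg_EFin; first exact: nearW.
  exact: (cvgM (cvg_cst (f t)) L).
- exact: integrable_abse.
- apply: aeW => t n /u01/andP[u0 u1]; rewrite /f_/=.
  rewrite lee_fin normrM ler_piMr//.
  have uk0 : (0 <= u t ^+ n)%R by rewrite exprn_ge0.
  have uk1 : (u t ^+ n <= 1)%R by rewrite exprn_ile1.
  rewrite expr0 mul1r ger0_norm ?mulr_ge0 ?exprn_ge0 ?subr_ge0//.
  by rewrite exprn_ile1 ?subr_ge0// lerBlDr lerDl.
move=> gi _.
have -> : (fun n => \int[mu]_(x in `[0%R, +oo[) f_ n x) = (fun=> 0).
  by apply/funext => n; rewrite integral_mul_pow_sub1// ltW.
move=> /cvg_lim; rewrite lim_cst// => /(_ (@ereal_hausdorff _)) g0.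
have aS : (`]a, +oo[ `<=` `[0%R, +oo[)%classic.
  by move=> t /=; rewrite !in_itv/= !andbT => /ltW; apply: le_trans; exact: ltW.
rewrite -(setIidr aS) integral_mkcondr [RHS]g0; apply: eq_integral => t _.
by rewrite patchE /g indicE; case: ifPn; rewrite ?mulr1 ?mulr0.
Qed.

(** The total integral (the transform at [s = 0]) and all tails vanish, so the primitive of [f]
    vanishes on the positive axis, while its derivative is [f] almost everywhere. *)
Lemma ae_eq0_of_laplace (f : R -> R) : (forall t : R, (t < 0)%R -> f t = 0%R) ->
  mu.-integrable setT (EFin \o f) ->
  (forall s : R, (0 <= s)%R ->
    \int[mu]_(t in `[0%R, +oo[) (f t * expR (- (s * t)))%:E = 0) ->
  {ae mu, forall t, f t = 0%R}.
Proof.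
move=> fneg fi f0.
have fi' (D : set R) : measurable D -> mu.-integrable D (EFin \o f).
  by move=> mD; apply: integrableS fi.
have mf : measurable_fun setT f.
  by apply/measurable_EFinP; apply: measurable_int fi.
have F0 (x : R) : (0 < x)%R -> (\int[mu]_(t in `]-oo, x]) f t)%R = 0%R.
  move=> x0; rewrite /Rintegral.
  have -> : (\int[mu]_(t in `]-oo, x]) (f t)%:E = 0)%E; last by [].
  have split_ : `[0%R, +oo[%classic = (`[0%R, x] `|` `]x, +oo[)%classic.
    by rewrite -itv_bndbnd_setU// bnd_simp ltW.
  have := f0 0%R (lexx _).
  under eq_integral do rewrite mul0r oppr0 expR0 mulr1.
  rewrite split_ integral_setU//=; last 2 first.
  - by apply/measurable_EFinP; exact: measurable_funTS.
  - apply/disj_setPRL => t /=; rewrite !in_itv/= andbT => xt /andP[_].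
    by rewrite leNgt xt.
  rewrite (integral_tail_eq0 _ _ x0) ?adde0//; last exact: fi'.
  (* Since [f] vanishes on the negative axis, the integrals over []-oo, x]] and [[0, x]] agree. *)
  move=> <-; rewrite [LHS]integral_mkcond [RHS]integral_mkcond.
  apply: eq_integral => t _; rewrite !patchE.
  rewrite !mem_setE !in_itv/=.
  have [t0|t0]/= := ltP t 0%R; last by [].
  by rewrite fneg//; case: ifP.
(* The point 0 is discarded: it is neither negative nor interior to the region where the primitive
   is known to vanish. *)
have ne0 : {ae mu, forall t, t <> 0%R}.
  exists [set 0%R]; split => //; first exact: lebesgue_measure_set1.
  by move=> t /= /contrapT.
have := FTC1Ny (fun y => fi' _ (measurable_itv _))
  (open_integrable_locally openT (fi' _ measurableT)).
move: ne0; apply: filterS2; first exact: (ae_filter_ringOfSetsType mu).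
move=> t /eqP; rewrite neq_lt => /orP[t0 _|t0 [_ <-]].
  exact: fneg.
rewrite derive1E (_ : 0%R = 'D_1 (cst 0%R : R -> R) t);
  last by rewrite derive_cst.
(* The primitive is zero on a whole neighbourhood of [t > 0], hence so is its derivative at [t]. *)
apply: near_eq_derive; near=> y.
by apply: F0; near: y; exact: lt_nbhsr.
Unshelve. all: by end_near. Qed.
End real_uniqueness.

(** * Modulus and exponential of complex numbers *)

Section modulus_cexp.
Context {R : realType}.
Implicit Types z w : R[i].

Lemma cReD z w : complex.Re (z + w) = complex.Re z + complex.Re w.
Proof. by case: z w => ? ? []. Qed.
Lemma cImD z w : complex.Im (z + w) = complex.Im z + complex.Im w.
Proof. by case: z w => ? ? []. Qed.
Lemma cReN z : complex.Re (- z) = - complex.Re z.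
Proof. by case: z. Qed.
Lemma cImN z : complex.Im (- z) = - complex.Im z.
Proof. by case: z. Qed.
Lemma cReM z w : complex.Re (z * w) =
  complex.Re z * complex.Re w - complex.Im z * complex.Im w.
Proof. by case: z w => ? ? []. Qed.
Lemma cImM z w : complex.Im (z * w) =
  complex.Re z * complex.Im w + complex.Im z * complex.Re w.
Proof. by case: z w => ? ? []. Qed.
Lemma cReZ z (t : R) : complex.Re (z * t%:C) = complex.Re z * t.
Proof. by rewrite cReM/= mulr0 subr0. Qed.
Lemma cImZ z (t : R) : complex.Im (z * t%:C) = complex.Im z * t.
Proof. by rewrite cImM/= mulr0 add0r. Qed.

Lemma normr_modulus z : `|z| = (modulus z)%:C.
Proof. by []. Qed.
Lemma modulus_ge0 z : 0 <= modulus z.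
Proof. by rewrite -ler0c -normr_modulus. Qed.
Lemma modulus0 : modulus (0 : R[i]) = 0.
Proof. by rewrite /modulus normr0. Qed.
Lemma modulusM z w : modulus (z * w) = modulus z * modulus w.
Proof. by apply: complexI; rewrite rmorphM -!normr_modulus normrM. Qed.
Lemma modulusN z : modulus (- z) = modulus z.
Proof. by rewrite /modulus normrN. Qed.
Lemma modulusD z w : modulus (z + w) <= modulus z + modulus w.
Proof. by rewrite -lecR rmorphD -!normr_modulus ler_normD. Qed.
Lemma modulusX z n : modulus (z ^+ n) = modulus z ^+ n.
Proof. by apply: complexI; rewrite rmorphXn -!normr_modulus normrX. Qed.
Lemma modulus_real (x : R) : modulus x%:C = `|x|.
Proof. by rewrite /modulus normc_def/= expr0n addr0 sqrtr_sqr. Qed.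
Lemma modulusE z :
  modulus z = Num.sqrt (complex.Re z ^+ 2 + complex.Im z ^+ 2).
Proof. by rewrite /modulus normc_def. Qed.

Lemma normr_Re_le z : `|complex.Re z| <= modulus z.
Proof. by rewrite modulusE -sqrtr_sqr ler_wsqrtr// lerDl sqr_ge0. Qed.
Lemma normr_Im_le z : `|complex.Im z| <= modulus z.
Proof. by rewrite modulusE -sqrtr_sqr ler_wsqrtr// lerDr sqr_ge0. Qed.
Lemma modulus_le z : modulus z <= `|complex.Re z| + `|complex.Im z|.
Proof.
rewrite [z in leLHS]complexE (le_trans (modulusD _ _))// modulusM !modulus_real.
by rewrite [X in _ + X * _](_ : _ =
  1) ?mul1r// modulusE/= expr0n expr1n add0r sqrtr1.
Qed.

Lemma cexpD z w : cexp (z + w) = cexp z * cexp w.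
Proof.
apply/eqP; rewrite eq_complex /cexp cReD cImD.
rewrite !(cReM,cImM) /= !(mul0r,subr0,addr0) expRD cosD sinD.
by apply/andP; split; apply/eqP; ring.
Qed.

Lemma cexp0 : cexp (0 : R[i]) = 1.
Proof.
by apply/eqP; rewrite eq_complex /cexp/= expR0 cos0 sin0 !(mul0r,mulr1,mulr0)
  subr0 addr0 !eqxx.
Qed.

Lemma cexpX z n : cexp z ^+ n = cexp (n%:R * z).
Proof.
elim: n => [|n IH]; first by rewrite mul0r cexp0.
by rewrite exprSr IH -cexpD -natr1 mulrDl mul1r.
Qed.

Lemma modulus_cexp z : modulus (cexp z) = expR (complex.Re z).
Proof.
rewrite /cexp modulusM modulus_real ger0_norm ?expR_ge0//.
by rewrite modulusE/= cos2Dsin2 sqrtr1 mulr1.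
Qed.

End modulus_cexp.

(** * Second-order Taylor estimate for the complex exponential, and derivatives from quadratic
    remainders *)

Section cexp_taylor.
Context {R : realType}.

Lemma sqr_normr (y : R) : y ^+ 2 = `|y| * `|y|.
Proof. by rewrite -normrM -expr2 ger0_norm ?sqr_ge0. Qed.

(** The mean value theorem between 0 and [y], for either sign of [y]. It yields in turn the bounds
    on [sin y], [cos y - 1] and [sin y - y]. *)
Lemma normr_le_MVT (f df : R -> R) (y B : R) : f 0 = 0 ->
  (forall x : R, is_derive x 1 f (df x)) ->
  (forall x : R, `|x| <= `|y| -> `|df x| <= B) -> `|f y| <= B * `|y|.
Proof.
move=> f0 fdf dfB.
have fc a b : {within `[a, b], continuous f}.
  apply: derivable_within_continuous => x _; exact: ex_derive.
have [y0|y0] := leP 0 y.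
  have [c + fy] := MVT_segment y0 (fun x _ => fdf x) (fc _ _).
  rewrite in_itv/= => /andP[c0 cy].
  move: fy; rewrite f0 !subr0 => ->; rewrite normrM ler_wpM2r//.
  by rewrite dfB// !ger0_norm.
have [c + fy] := MVT_segment (ltW y0) (fun x _ => fdf x) (fc _ _).
rewrite in_itv/= => /andP[yc c0].
move: fy; rewrite f0 !sub0r => fy; rewrite -normrN fy normrM normrN ler_wpM2r//.
by rewrite dfB// !ler0_norm ?lerN2// ltW.
Qed.

Lemma normr_sin_le (y : R) : `|sin y| <= `|y|.
Proof.
rewrite -[leRHS]mul1r; apply: (normr_le_MVT _ cos) => [|x _].
  exact: sin0.
by rewrite ler_norml cos_geN1 cos_le1.
Qed.

Lemma normr_cos_sub1_le (y : R) : `|cos y - 1| <= y ^+ 2.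
Proof.
rewrite sqr_normr; apply: (normr_le_MVT (fun x => cos x - 1)
  (fun x => - sin x)).
- by rewrite cos0 subrr.
- by move=> x; apply: is_derive_eq; rewrite subr0.
- by move=> x xy; rewrite normrN (le_trans (normr_sin_le _)).
Qed.

Lemma normr_sin_sub_le (y : R) : `|sin y - y| <= y ^+ 2.
Proof.
have cos1 (x : R) : `|cos x - 1| <= `|x|.
  rewrite -[leRHS]mul1r;
    apply: (normr_le_MVT (fun x => cos x - 1) (fun x => - sin x)).
  - by rewrite cos0 subrr.
  - by move=> {}x; apply: is_derive_eq; rewrite subr0.
  - by move=> {}x _; rewrite normrN sin_max.
rewrite sqr_normr.
apply: (normr_le_MVT (fun x => sin x - x) (fun x => cos x - 1)) => [|x xy].
  by rewrite sin0 subrr.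
exact: le_trans (cos1 x) xy.
Qed.

(** With [z = x + iy], the real part is [e^x (cos y - 1) + (e^x - 1 - x)] and the imaginary part
    [e^x (sin y - y) + (e^x - 1) y]; each of the four pieces is at most [e^r |z|^2]. *)
Lemma cexp_sub1_sub_le (r : R) (z : R[i]) : modulus z <= r ->
  modulus (cexp z - 1 - z) <= (4 * expR r) * modulus z ^+ 2.
Proof.
move=> zr; set x := complex.Re z; set y := complex.Im z; set m := modulus z.
have m0 : 0 <= m by exact: modulus_ge0.
have xm : `|x| <= m by exact: normr_Re_le.
have ym : `|y| <= m by exact: normr_Im_le.
have ym2 : y ^+ 2 <= m ^+ 2 by rewrite sqr_normr expr2 ler_pM.
have E1 : 1 <= expR r by rewrite -expR0 ler_expR (le_trans m0).
have Ex : expR x <= expR r.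
  by rewrite ler_expR (le_trans (ler_norm _))// (le_trans xm).
have Ex0 : 0 < expR x by exact: expR_gt0.
have h1 : 1 + x <= expR x by exact: expR_ge1Dx.
(* This is [1 - x <= expR (- x)] multiplied by [expR x]. *)
have h2 : expR x - 1 <= x * expR x.
  have := expR_ge1Dx (- x); rewrite expRN => h.
  have : (1 - x) * expR x <= (expR x)^-1 * expR x by rewrite ler_wpM2r// ltW.
  by rewrite mulVf ?gt_eqF// => ?; lra.
have hx1 : `|expR x - 1| <= expR r * m.
  have mE : m <= expR r * m by rewrite ler_peMl.
  have := xm; rewrite ler_norml => /andP[xm1 xm2].
  rewrite ler_norml; apply/andP; split; first by lra.
  rewrite (le_trans h2)// (le_trans (ler_norm _))// normrM mulrC.
  by rewrite ger0_norm ?ler_pM// ltW.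
have hx2 : `|expR x - 1 - x| <= expR r * m ^+ 2.
  rewrite ger0_norm; last by lra.
  have -> : expR r * m ^+ 2 = m * (expR r * m) by ring.
  have : x * (expR x - 1) <= m * (expR r * m).
    by rewrite (le_trans (ler_norm _))// normrM ler_pM.
  by apply: le_trans; lra.
rewrite (le_trans (modulus_le _))//.
have -> : complex.Re (cexp z - 1 - z) = expR x * (cos y - 1) + (expR x - 1 - x).
  rewrite !cReD !cReN /cexp -/x -/y [in X in X - _]cReM/= mul0r; ring.
have -> : complex.Im (cexp z - 1 - z) = expR x * (sin y - y) + (expR x - 1) * y.
  rewrite !cImD !cImN /cexp -/x -/y [in X in X - _]cImM/= mul0r; ring.
have a1 : `|expR x * (cos y - 1)| <= expR r * m ^+ 2.
  by rewrite normrM ger0_norm ?expR_ge0// ler_pM ?expR_ge0//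
    (le_trans (normr_cos_sub1_le _)).
have a2 : `|expR x * (sin y - y)| <= expR r * m ^+ 2.
  by rewrite normrM ger0_norm ?expR_ge0// ler_pM ?expR_ge0//
    (le_trans (normr_sin_sub_le _)).
have a3 : `|(expR x - 1) * y| <= expR r * m ^+ 2.
  by rewrite normrM (_ : _ * m ^+ 2 = expR r * m * m) ?ler_pM//; ring.
have b1 := ler_normD (expR x * (cos y - 1)) (expR x - 1 - x).
have b2 := ler_normD (expR x * (sin y - y)) ((expR x - 1) * y).
lra.
Qed.

End cexp_taylor.

(** A quadratic remainder keeps the difference quotient within [K |h|] of [L]. *)
Lemma cderiven1_quadratic (C : numFieldType) (F : C -> C) (a L K : C) :
  (forall h, `|h| <= 1 -> `|F (h + a) - F a - h * L| <= K * `|h| ^+ 2) ->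
  cderiven 1 F a = L.
Proof.
(* Taking [h = 1] in the bound shows that [K] is nonnegative. *)
move=> FL; have K0 : 0 <= K.
  by have := FL 1; rewrite normr1 expr1n mulr1 => /(_ (lexx _));
    exact: le_trans.
apply: cvg_lim; first exact: norm_hausdorff.
apply/cvgrPdist_le => e e0.
near=> h.
have h0 : h != 0 by near: h; exact: nbhs_dnbhs_neq.
have h1 : `|h| <= 1.
  near: h; apply: dnbhs0_le; exact: ltr01.
(* Dividing by [K + 1] rather than [K] covers the case [K = 0]. *)
have he : `|h| <= e / (K + 1).
  near: h; apply: dnbhs0_le; rewrite divr_gt0// ltr_wpDl//.
have -> : L - h^-1 *: (F (h + a) - F a) = - (h^-1 * (F (h + a) - F a - h * L)).
  by rewrite /GRing.scale/= [in RHS]mulrBr mulKf// opprB.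
rewrite normrN normrM normfV ler_pdivrMl ?normr_gt0//.
rewrite (le_trans (FL _ h1))// expr2 mulrCA ler_wpM2l//.
rewrite (@le_trans _ _ ((K + 1) * `|h|))// ?ler_wpM2r ?lerDl//.
by rewrite mulrC -ler_pdivlMr// ltr_wpDl.
Unshelve. all: by end_near. Qed.

(** * Measurability of complex-valued functions *)

Section cmeasurable.
Context {R : realType}.
Implicit Types f g : R -> R[i].

Definition cmeasurable f :=
  measurable_fun setT (fun t => complex.Re (f t)) /\
  measurable_fun setT (fun t => complex.Im (f t)).

Lemma cmeasurable_cst c : cmeasurable (fun=> c).
Proof. by split; exact: measurable_cst. Qed.

Lemma cmeasurable_real (h : R -> R) :
  measurable_fun setT h -> cmeasurable (fun t => (h t)%:C).
Proof. by split => //=; exact: measurable_cst. Qed.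

Lemma cmeasurableD f g : cmeasurable f -> cmeasurable g ->
  cmeasurable (fun t => f t + g t).
Proof.
move=> [fr fi] [gr gi]; split.
- by under eq_fun do rewrite cReD; exact: measurable_funD.
- by under eq_fun do rewrite cImD; exact: measurable_funD.
Qed.

Lemma cmeasurableM f g : cmeasurable f -> cmeasurable g ->
  cmeasurable (fun t => f t * g t).
Proof.
move=> [fr fi] [gr gi]; split.
- under eq_fun do rewrite cReM.
  by apply: measurable_funB; exact: measurable_funM.
- under eq_fun do rewrite cImM.
  by apply: measurable_funD; exact: measurable_funM.
Qed.

Lemma cmeasurableN f : cmeasurable f -> cmeasurable (fun t => - f t).
Proof.
move=> fm; under eq_fun do rewrite -mulN1r.
by apply: cmeasurableM => //; exact: cmeasurable_cst.
Qed.

Lemma cmeasurable_sum I (r : seq I) (F : I -> R -> R[i]) :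
  (forall i, cmeasurable (F i)) -> cmeasurable (fun t => \sum_(i <- r) F i t).
Proof.
move=> Fm; elim: r => [|i r IH].
  by under eq_fun do rewrite big_nil; exact: cmeasurable_cst.
by under eq_fun do rewrite big_cons; exact: cmeasurableD.
Qed.

Lemma cmeasurable_cexp f : cmeasurable f -> cmeasurable (fun t => cexp (f t)).
Proof.
move=> [fr fi]; rewrite /cexp; apply: cmeasurableM.
  by apply: cmeasurable_real; exact: measurableT_comp.
split => /=; (apply: measurableT_comp => //; apply: continuous_measurable_fun).
- exact: continuous_cos.
- exact: continuous_sin.
Qed.

Lemma cmeasurable_comp f (phi : R -> R) : cmeasurable f ->
  measurable_fun setT phi -> cmeasurable (fun t => f (phi t)).
Proof.
move=> [fr fi] mphi; split.
- exact: (measurableT_comp fr).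
- exact: (measurableT_comp fi).
Qed.

Lemma cmeasurable_if (b : R -> bool) f g : measurable_fun setT b ->
  cmeasurable f -> cmeasurable g ->
  cmeasurable (fun t => if b t then f t else g t).
Proof.
move=> mb [fr fi] [gr gi]; split.
- by under eq_fun do rewrite (fun_if (@complex.Re _));
    exact: measurable_fun_ifT.
- by under eq_fun do rewrite (fun_if (@complex.Im _));
    exact: measurable_fun_ifT.
Qed.

Lemma measurable_modulus f : cmeasurable f ->
  measurable_fun setT (fun t => modulus (f t)).
Proof.
move=> [fr fi]; under eq_fun do rewrite modulusE.
have ms : measurable_fun setT (@Num.sqrt R).
  by apply: continuous_measurable_fun; exact: sqrt_continuous.
by apply: (measurableT_comp ms); apply: measurable_funD; exact: measurable_funX.
Qed.

Lemma cintegrable_measurable f :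
  cintegrable setT f -> cmeasurable f.
Proof.
move=> [fr fi]; split; apply/measurable_EFinP.
- exact: measurable_int fr.
- exact: measurable_int fi.
Qed.

Lemma measurable_in_itv (i : interval R) : measurable_fun setT
  (fun t => t \in i).
Proof.
apply: (measurable_fun_bool true).
by rewrite setTI [X in measurable X](_ : _ = [set` i]) //;
  exact: measurable_itv.
Qed.

End cmeasurable.

(** * Locally bounded multipliers and bounded kernels of compact support *)

Section bounded_kernels.
Context {R : realType}.
Notation mu := (@lebesgue_measure R).
Implicit Types f g phi : R -> R[i].

(** The class of multipliers. Bounds are asked only on each [[0, T]], so that polynomials and
    exponentials belong to it. *)
Definition loc_bounded phi := cmeasurable phi /\
  forall T, exists B, forall t : R, t \in `[0, T] -> modulus (phi t) <= B.

Lemma loc_bounded_cst c : loc_bounded (fun=> c).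
Proof. by split; [exact: cmeasurable_cst|move=> T; exists (modulus c)]. Qed.

Lemma loc_bounded_id : loc_bounded (fun t => t%:C).
Proof.
split; first by apply: cmeasurable_real; exact: measurable_id.
move=> T; exists T => t; rewrite in_itv/= => /andP[t0 tT].
by rewrite modulus_real ger0_norm.
Qed.

Lemma loc_bounded_cexp (s : R[i]) : loc_bounded (fun t => cexp (s * t%:C)).
Proof.
split.
  apply: cmeasurable_cexp; apply: cmeasurableM; first exact: cmeasurable_cst.
  by apply: cmeasurable_real; exact: measurable_id.
move=> T; exists (expR (`|complex.Re s| * T)) => t.
rewrite in_itv/= => /andP[t0 tT].
rewrite modulus_cexp cReZ ler_expR (le_trans (ler_norm _))// normrM ler_wpM2l//.
by rewrite ger0_norm.
Qed.

Lemma loc_boundedM f g : loc_bounded f -> loc_bounded g ->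
  loc_bounded (fun t => f t * g t).
Proof.
move=> [mf bf] [mg bg]; split; first exact: cmeasurableM.
move=> T; have [B1 h1] := bf T; have [B2 h2] := bg T.
by exists (B1 * B2) => t tT; rewrite modulusM ler_pM ?modulus_ge0 ?h1 ?h2.
Qed.

Lemma loc_boundedN f : loc_bounded f -> loc_bounded (fun t => - f t).
Proof.
move=> [mf bf]; split; first exact: cmeasurableN.
by move=> T; have [B h] := bf T; exists B => t /h; rewrite modulusN.
Qed.

Lemma loc_boundedD f g : loc_bounded f -> loc_bounded g ->
  loc_bounded (fun t => f t + g t).
Proof.
move=> [mf bf] [mg bg]; split; first exact: cmeasurableD.
move=> T; have [B1 h1] := bf T; have [B2 h2] := bg T.
by exists (B1 + B2) => t tT; rewrite (le_trans (modulusD _ _))// lerD ?h1 ?h2.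
Qed.

Lemma loc_boundedX f n : loc_bounded f -> loc_bounded (fun t => f t ^+ n).
Proof.
move=> fb; elim: n => [|n IH].
  by under eq_fun do rewrite expr0; exact: loc_bounded_cst.
by under eq_fun do rewrite exprS; exact: loc_boundedM.
Qed.

Lemma loc_bounded_sum I (r : seq I) (F : I -> R -> R[i]) :
  (forall i, loc_bounded (F i)) -> loc_bounded (fun t => \sum_(i <- r) F i t).
Proof.
move=> Fb; elim: r => [|i r IH].
  by under eq_fun do rewrite big_nil; exact: loc_bounded_cst.
by under eq_fun do rewrite big_cons; exact: loc_boundedD.
Qed.

(** The class on which the transform identities are proved: it consists of integrable functions, is
    stable under sums and multipliers, and contains [theta] and the exponential-polynomial
    kernels. *)
Definition bounded_kernel (T : R) f := [/\ cmeasurable f,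
  forall t, t \notin `[0, T] -> f t = 0 &
  exists B, forall t, modulus (f t) <= B].

Lemma bounded_kernel_if T phi : loc_bounded phi ->
  bounded_kernel T (fun t => if t \in `[0, T] then phi t else 0).
Proof.
move=> [mphi bphi]; split.
- by apply: cmeasurable_if => //; exact: measurable_in_itv.
- by move=> t /negbTE ->.
(* For [T < 0] the interval is empty and [B] may be negative, hence the absolute value. *)
- have [B h] := bphi T; exists `|B| => t; case: ifPn => [/h/le_trans->//|_].
    exact: ler_norm.
  by rewrite modulus0.
Qed.

Lemma bounded_kernelM T f phi : bounded_kernel T f -> loc_bounded phi ->
  bounded_kernel T (fun t => phi t * f t).
Proof.
move=> [mf f0 [B1 h1]] [mphi bphi]; split; first exact: cmeasurableM.
  by move=> t /f0 ->; rewrite mulr0.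
have [B2 h2] := bphi T; exists (`|B2| * B1) => t; rewrite modulusM.
have [tT|/f0 ->] := boolP (t \in `[0, T]).
  by rewrite ler_pM ?modulus_ge0// (le_trans (h2 _ tT))// ler_norm.
by rewrite modulus0 mulr0 mulr_ge0// (le_trans (modulus_ge0 (f t))).
Qed.

Lemma bounded_kernelD T f g : bounded_kernel T f -> bounded_kernel T g ->
  bounded_kernel T (fun t => f t + g t).
Proof.
move=> [mf f0 [B1 h1]] [mg g0 [B2 h2]]; split; first exact: cmeasurableD.
  by move=> t tT; rewrite f0// g0// addr0.
by exists (B1 + B2) => t; rewrite (le_trans (modulusD _ _))// lerD.
Qed.

Lemma bounded_kernel0 T : bounded_kernel T (fun=> 0).
Proof.
split => //.
by exists 0 => t; rewrite modulus0.
Qed.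

Lemma bounded_kernel_sum T I (r : seq I) (F : I -> R -> R[i]) :
  (forall i, bounded_kernel T (F i)) ->
  bounded_kernel T (fun t => \sum_(i <- r) F i t).
Proof.
move=> Fb; elim: r => [|i r IH].
  by under eq_fun do rewrite big_nil; exact: bounded_kernel0.
by under eq_fun do rewrite big_cons; exact: bounded_kernelD.
Qed.

Lemma bounded_kernel_shift T T' a f : 0 <= a -> T + a <= T' ->
  bounded_kernel T f -> bounded_kernel T' (fun t => f (t - a)).
Proof.
move=> a0 TT' [mf f0 [B h]]; split; last by exists B => t; exact: h.
  by apply: cmeasurable_comp => //; exact: measurable_funB.
move=> t; rewrite in_itv/= => tT; apply: f0; rewrite in_itv/=.
apply: contra tT => /andP[ta tT]; apply/andP; split; lra.
Qed.

Lemma integrable_bounded_support (f : R -> R) (T B : R) :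
  measurable_fun setT f -> (forall t, t \notin `[0, T] -> f t = 0) ->
  (forall t, `|f t| <= B) -> mu.-integrable setT (EFin \o f).
Proof.
move=> mf f0 fB.
have fi : mu.-integrable `[0, T] (EFin \o f).
  apply: measurable_bounded_integrable => //.
  - by rewrite /= lebesgue_measure_itv/=; case: ifP => // _; rewrite ltry.
  - exact: measurable_funTS.
  - exists B; split; first exact: num_real.
    by move=> M BM t _; rewrite /= (le_trans (fB t))// ltW.
have -> : EFin \o f = (EFin \o f) \_ `[0, T].
  apply/funext => t; rewrite patchE mem_setE; case: ifPn => // /f0.
  by move=> /= ->.
exact: (iffLR (@integrable_mkcond _ _ R mu `[0, T] _ (measurable_itv _)) fi).
Qed.

Lemma bounded_kernel_integrable T f : bounded_kernel T f -> cintegrable setT f.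
Proof.
move=> [[mr mi] f0 [B h]]; split.
- apply: (@integrable_bounded_support _ T B) => //.
    by move=> t /f0 ->.
  by move=> t; exact: le_trans (normr_Re_le _) _.
- apply: (@integrable_bounded_support _ T B) => //.
    by move=> t /f0 ->.
  by move=> t; exact: le_trans (normr_Im_le _) _.
Qed.

Lemma bounded_kernel_L1 T f : bounded_kernel T f -> L1_halfline f.
Proof.
move=> fT; split; last exact: bounded_kernel_integrable fT.
have [_ f0 _] := fT => t t0; apply: f0.
by rewrite in_itv/= negb_and -ltNge t0.
Qed.

End bounded_kernels.

(** * Integrals of complex-valued functions *)

Section cintegral.
Context {R : realType}.
Notation mu := (@lebesgue_measure R).
Implicit Types f g : R -> R[i].

Lemma eq_complexP (z w : R[i]) : complex.Re z = complex.Re w ->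
  complex.Im z = complex.Im w -> z = w.
Proof. by move=> h1 h2; apply/eqP; rewrite eq_complex h1 h2 !eqxx. Qed.

Lemma cintegralD f g : cintegrable setT f -> cintegrable setT g ->
  cintegral setT (fun t => f t + g t) = cintegral setT f + cintegral setT g.
Proof.
move=> [fr fi] [gr gi]; apply: eq_complexP; rewrite ?cReD ?cImD /cintegral/=.
- by under eq_Rintegral do rewrite cReD; rewrite RintegralD.
- by under eq_Rintegral do rewrite cImD; rewrite RintegralD.
Qed.

Lemma cintegralZ c f : cintegrable setT f ->
  cintegral setT (fun t => c * f t) = c * cintegral setT f.
Proof.
move=> [fr fi].
have iZ (k : R) (h : R -> R) : mu.-integrable setT (EFin \o h) ->
    mu.-integrable setT (EFin \o (fun t => k * h t)).
  by move=> hi; exact: (integrableZl measurableT k hi).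
apply: eq_complexP; rewrite ?cReM ?cImM /cintegral/=.
- under eq_Rintegral do rewrite cReM.
  by rewrite RintegralB ?RintegralZl//; exact: iZ.
- under eq_Rintegral do rewrite cImM.
  by rewrite RintegralD ?RintegralZl//; exact: iZ.
Qed.

(** The factor 2 comes from bounding the real and imaginary parts separately. *)
Lemma modulus_cintegral_le T B f : 0 <= T -> bounded_kernel T f ->
  (forall t, t \in `[0, T] -> modulus (f t) <= B) ->
  modulus (cintegral setT f) <= 2 * (B * T).
Proof.
move=> T0 fT fB.
have real_le (h : R -> R) : (forall t, t \notin `[0, T] -> h t = 0) ->
    mu.-integrable setT (EFin \o h) -> (forall t, t \in `[0, T] ->
      `|h t| <= B) ->
    `|\int[mu]_(t in setT) h t| <= B * T.
  move=> h0 hi hB.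
  have hi' : mu.-integrable `[0, T] (EFin \o h) by exact: integrableS hi.
  have -> : \int[mu]_(t in setT) h t = \int[mu]_(t in `[0, T]) h t.
    rewrite [RHS]Rintegral_mkcond; apply: eq_Rintegral => t _.
    by rewrite patchE mem_setE; case: ifPn => // /h0.
  rewrite (le_trans (le_normr_Rintegral _ _))//.
  have <- : \int[mu]_(t in `[0, T]) B = B * T.
    rewrite Rintegral_cst//; congr (_ * _).
    rewrite /= lebesgue_measure_itv/= lte_fin; case: ifPn => [_|].
      by rewrite -EFinB subr0.
    by rewrite -leNgt => T0'; apply/eqP; rewrite eq_le T0 T0'.
  apply: le_Rintegral => //.
  - exact: integrable_norm.
  - apply: measurable_bounded_integrable => //.
      by rewrite /= lebesgue_measure_itv/=; case: ifP => // _; rewrite ltry.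
    exists B; split; first exact: num_real.
    have B0 : 0 <= B.
      by rewrite (le_trans (normr_ge0 (h 0)))// hB// in_itv/= lexx T0.
    by move=> M BM t _; rewrite /= ger0_norm// ltW.
have [fr fi] := bounded_kernel_integrable _ _ fT.
have [_ f0 _] := fT.
rewrite (le_trans (modulus_le _))// mulr2n mulrDl mul1r lerD// real_le//.
- by move=> t /f0 ->.
- by move=> t /fB; apply: le_trans; exact: normr_Re_le.
- by move=> t /f0 ->.
- by move=> t /fB; apply: le_trans; exact: normr_Im_le.
Qed.

End cintegral.

(** * Laplace transforms of bounded kernels: linearity, derivatives, translations *)

Section laplace.
Context {R : realType}.
Notation mu := (@lebesgue_measure R).
Implicit Types f g : R -> R[i].

Lemma loc_bounded_laplace (s : R[i]) :
  loc_bounded (fun t : R => cexp (- (s * t%:C))).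
Proof. by under eq_fun do rewrite -mulNr; exact: loc_bounded_cexp. Qed.

(** As [f] vanishes off [[0, T]], the integral extends to the whole line, where the integrand is
    again a bounded kernel. *)
Lemma laplaceE T f s : bounded_kernel T f ->
  laplace f s = cintegral setT (fun t => cexp (- (s * t%:C)) * f t).
Proof.
move=> [_ f0 _]; have fneg t : t \notin `[0, +oo[ -> f t = 0.
  move=> t0; apply: f0; apply: contra t0.
  by rewrite !in_itv/= andbT => /andP[].
have mk (h : R -> R) : (forall t, t \notin `[0, +oo[ -> h t = 0) ->
    \int[mu]_(t in `[0, +oo[) h t = \int[mu]_(t in setT) h t.
  move=> h0; rewrite [LHS]Rintegral_mkcond; apply: eq_Rintegral => t _.
  by rewrite patchE mem_setE; case: ifPn => // /h0.
rewrite /laplace /cintegral; congr (_ +i* _).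
- rewrite mk => [|t /fneg ->]; last by rewrite mul0r.
  by apply: eq_Rintegral => t _; rewrite mulrC.
- rewrite mk => [|t /fneg ->]; last by rewrite mul0r.
  by apply: eq_Rintegral => t _; rewrite mulrC.
Qed.

Lemma laplaceD T f g s : bounded_kernel T f -> bounded_kernel T g ->
  laplace (fun t => f t + g t) s = laplace f s + laplace g s.
Proof.
move=> fT gT; have ls := loc_bounded_laplace s.
rewrite (laplaceE T)//; last exact: bounded_kernelD.
under eq_fun do rewrite mulrDr.
by rewrite cintegralD ?(laplaceE T)//;
  apply: (bounded_kernel_integrable T); exact: bounded_kernelM.
Qed.

Lemma laplaceZ T f c s : bounded_kernel T f ->
  laplace (fun t => c * f t) s = c * laplace f s.
Proof.
move=> fT; have ls := loc_bounded_laplace s.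
rewrite (laplaceE T)//; last by apply: bounded_kernelM => //;
  exact: loc_bounded_cst.
under eq_fun do rewrite mulrCA.
by rewrite cintegralZ ?(laplaceE T)//;
  apply: (bounded_kernel_integrable T); exact: bounded_kernelM.
Qed.

Lemma laplace_sum T I (r : seq I) (F : I -> R -> R[i]) s :
  (forall i, bounded_kernel T (F i)) ->
  laplace (fun t => \sum_(i <- r) F i t) s = \sum_(i <- r) laplace (F i) s.
Proof.
move=> FT; elim: r => [|i r IH].
  under eq_fun do rewrite big_nil; rewrite big_nil.
  have := laplaceZ T (fun=> 0) 0 s (bounded_kernel0 T).
  by under eq_fun do rewrite mul0r; rewrite mul0r.
under eq_fun do rewrite big_cons; rewrite big_cons -IH (laplaceD T)//.
exact: bounded_kernel_sum.
Qed.

(** The remainder is the integral of [(exp(- h t) - 1 + h t) exp(- s t) f(t)], which the Taylor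
    estimate makes quadratic in [h], uniformly for [t] in [[0, T]]. *)
Lemma cderiven1_laplace T f s : 0 <= T -> bounded_kernel T f ->
  cderiven 1 (laplace f) s = laplace (fun t => - t%:C * f t) s.
Proof.
move=> T0 fT.
pose e t := cexp (- (s * t%:C)) * f t.
have eT : bounded_kernel T e by apply: bounded_kernelM => //;
  exact: loc_bounded_laplace.
have [_ _ [B eB]] := eT.
have B0 : 0 <= B by exact: le_trans (modulus_ge0 _) (eB 0).
(* The 2 and the last [T] come from [modulus_cintegral_le], [4 * expR T] is the Taylor constant for
   [|h| t <= T], and [T ^+ 2] bounds [t^2]. *)
pose K := 2 * (B * (4 * expR T * T ^+ 2) * T).
have tN : loc_bounded (fun t : R => - t%:C).
  exact: loc_boundedN (@loc_bounded_id R).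
apply: (@cderiven1_quadratic _ _ _ _ K%:C) => h.
rewrite !normr_modulus -[1]/(1%:C) lecR => h1.
rewrite -rmorphXn -rmorphM lecR.
have hN : loc_bounded (fun t : R => cexp (- (h * t%:C)))
  by exact: loc_bounded_laplace.
have -> : laplace f (h + s) - laplace f s - h * laplace
  (fun t => - t%:C * f t) s =
    cintegral setT (fun t => (cexp (- (h * t%:C)) - 1 - - (h * t%:C)) * e t).
  have -> : (fun t => (cexp (- (h * t%:C)) - 1 - - (h * t%:C)) * e t) =
      (fun t => cexp (- (h * t%:C)) * e t + (- 1 * e t + h * (t%:C * e t))).
    by apply/funext => t; ring.
  have ci g : bounded_kernel T g -> cintegrable setT g
    by exact: bounded_kernel_integrable.
  have cT c : loc_bounded (fun _ : R => c) by exact: loc_bounded_cst.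
  have idT : loc_bounded (fun t : R => t%:C) by exact: loc_bounded_id.
  have teT : bounded_kernel T (fun t => t%:C * e t) by exact: bounded_kernelM.
  have neT : bounded_kernel T (fun t => - 1 * e t) by exact: bounded_kernelM.
  have hteT : bounded_kernel T (fun t => h * (t%:C * e t))
    by exact: bounded_kernelM.
  rewrite cintegralD; first last.
  - by apply: ci; exact: bounded_kernelD.
  - by apply: ci; exact: bounded_kernelM.
  rewrite cintegralD ?cintegralZ; [|exact: ci..].
  have -> : laplace f (h + s) =
    cintegral setT (fun t => cexp (- (h * t%:C)) * e t).
    rewrite (laplaceE T)//; congr (cintegral _ _); apply/funext => t.
    by rewrite mulrA -cexpD -opprD -mulrDl.
  rewrite (laplaceE T)// (laplaceE T); last exact: bounded_kernelM.
  have -> : (fun t => cexp (- (s * t%:C)) * (- t%:C * f t)) =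
      (fun t => - 1 * (t%:C * e t)) by apply/funext => t; rewrite /e; ring.
  by rewrite cintegralZ; [rewrite -/e; ring|exact: ci].
have dT : bounded_kernel T
  (fun t => (cexp (- (h * t%:C)) - 1 - - (h * t%:C)) * e t).
  apply: bounded_kernelM => //; apply: loc_boundedD; last first.
    apply: loc_boundedN; apply: loc_boundedN.
    exact: loc_boundedM (loc_bounded_cst h) (@loc_bounded_id R).
  by apply: loc_boundedD => //; exact: loc_bounded_cst.
have le_d t : t \in `[0, T] ->
    modulus ((cexp (- (h * t%:C)) - 1 - - (h * t%:C)) * e t) <=
    B * (4 * expR T * T ^+ 2) * modulus h ^+ 2.
  rewrite in_itv/= => /andP[t0 tT].
  have mht : modulus (- (h * t%:C)) = modulus h * t.
    by rewrite modulusN modulusM modulus_real ger0_norm.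
  have htT : modulus h * t <= modulus h * T by rewrite ler_wpM2l// modulus_ge0.
  have ht0 : 0 <= modulus h * t by rewrite mulr_ge0// modulus_ge0.
  have hT : modulus h * t <= T.
    by rewrite (le_trans htT)// ler_piMl.
  rewrite modulusM mulrC -[leRHS]mulrA ler_pM ?modulus_ge0//.
  rewrite (le_trans (cexp_sub1_sub_le T _ _)) ?mht//.
  rewrite -[leRHS]mulrA ler_pM2l ?mulr_gt0 ?expR_gt0//.
  by rewrite -exprMn [T * _]mulrC lerXn2r ?nnegrE// (le_trans ht0).
have := modulus_cintegral_le T _ _ T0 dT le_d.
by move/le_trans; apply; rewrite /K le_eqVlt; apply/orP; left; apply/eqP; ring.
Qed.

Lemma cderiven_laplace T f k : 0 <= T -> bounded_kernel T f ->
  cderiven k (laplace f) = laplace (fun t => (- t%:C) ^+ k * f t).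
Proof.
move=> T0 fT; elim: k => [|k IH].
  by congr laplace; apply/funext => t; rewrite expr0 mul1r.
have tk : loc_bounded (fun t : R => (- t%:C) ^+ k).
  apply: loc_boundedX; exact: loc_boundedN (@loc_bounded_id R).
rewrite -[LHS]/(cderiven 1 (cderiven k (laplace f))) IH; apply/funext => s.
rewrite (cderiven1_laplace T)//; last exact: bounded_kernelM.
by congr (laplace _ s); apply/funext => t; rewrite exprS mulrA.
Qed.

(** The image of Lebesgue measure under [t - a] gives half-open intervals their length, so it is
    Lebesgue measure by uniqueness. *)
Lemma ge0_integral_translate (a : R) (f : R -> \bar R) :
  measurable_fun setT f -> (forall t, 0 <= f t)%E ->
  (\int[mu]_t f (t - a)%R = \int[mu]_t f t)%E.
Proof.
move=> mf f0.
have mphi : measurable_fun setT (fun t : R => t - a) by exact: measurable_funB.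
have := @ge0_integral_pushforward _ _ (measurableTypeR R) (measurableTypeR R)
  R _ mphi mu setT f measurableT mf
  (fun t _ => f0 t).
rewrite preimage_setT => <-; apply: eq_measure_integral => A mA _.
apply/esym; apply: lebesgue_measure_unique => // X [[x y] _ <-].
rewrite /= /pushforward.
rewrite (_ : _ @^-1` _ = `]x + a, y + a]%classic); last first.
  by apply/seteqP; split => t /=; rewrite !in_itv/= ltrBrDr lerBlDr.
rewrite !lebesgue_measure_itv/= !lte_fin ltrD2r; case: ifP => // _.
by rewrite -!EFinB; congr EFin; ring.
Qed.

Lemma Rintegral_translate (a : R) (f : R -> R) : measurable_fun setT f ->
  \int[mu]_t f (t - a) = \int[mu]_t f t.
Proof.
move=> mf; rewrite /Rintegral; congr fine.
have mf' : measurable_fun setT (EFin \o f) by exact/measurable_EFinP.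
rewrite [LHS]integralE [RHS]integralE.
have mp := measurable_funepos mf'; have mn := measurable_funeneg mf'.
rewrite -(ge0_integral_translate a _ mp)// -(ge0_integral_translate a _ mn)//.
by congr (_ - _)%E; apply: eq_integral => t _; rewrite ?funeposE ?funenegE.
Qed.

Lemma laplace_translate T a f s : 0 <= a -> bounded_kernel T f ->
  laplace (fun t => f (t - a)) s = cexp (- (s * a%:C)) * laplace f s.
Proof.
move=> a0 fT.
have sT := bounded_kernel_shift _ _ _ _ a0 (lexx (T + a)) fT.
rewrite (laplaceE _ _ _ sT) (laplaceE _ _ _ fT).
have eT : bounded_kernel T (fun t => cexp (- (s * t%:C)) * f t).
  by apply: bounded_kernelM => //; exact: loc_bounded_laplace.
have eT' := bounded_kernelM _ _ _ eT (loc_bounded_cst (cexp (- (s * a%:C)))).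
rewrite -cintegralZ; last exact: bounded_kernel_integrable eT.
have [[mr mi] _ _] := eT'.
(* After translation both integrands agree, by [exp(- s a) exp(- s (t - a)) = exp(- s t)]. *)
rewrite /cintegral -(Rintegral_translate a _ mr) -(Rintegral_translate a _ mi).
by congr (_ +i* _); apply: eq_Rintegral => t _; congr (_ _);
  rewrite mulrA -cexpD -opprD -mulrDr -rmorphD (addrC a (t - a)) subrK.
Qed.

End laplace.

(** * Injectivity of the Laplace transform on complex kernels *)

Section laplace_unique.
Context {R : realType}.
Notation mu := (@lebesgue_measure R).

Lemma real_laplace_unique (h1 h2 : R -> R) :
  (forall t : R, t < 0 -> h1 t = 0) -> (forall t : R, t < 0 -> h2 t = 0) ->
  mu.-integrable setT (EFin \o h1) -> mu.-integrable setT (EFin \o h2) ->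
  (forall s : R, 0 <= s ->
    \int[mu]_(t in `[0, +oo[) (h1 t * expR (- (s * t))) =
    \int[mu]_(t in `[0, +oo[) (h2 t * expR (- (s * t)))) ->
  {ae mu, forall t, h1 t = h2 t}.
Proof.
move=> h10 h20 i1 i2 h12.
have : {ae mu, forall t, h1 t - h2 t = 0}.
  apply: ae_eq0_of_laplace.
  - by move=> t t0; rewrite h10// h20// subrr.
  - have := integrableB measurableT i1 i2.
    by apply: eq_integrable => // t _ /=.
  - move=> s s0.
    have ie (h : R -> R) : mu.-integrable setT (EFin \o h) ->
        mu.-integrable `[0, +oo[ (fun t => (h t * expR (- (s * t)))%:E).
      move=> hi; apply: (integrable_mul_bounded _ _ _ 1) => //.
      - exact: integrableS hi.
      - do 2 apply: measurableT_comp => //.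
      - move=> t; rewrite /= in_itv/= andbT => t0.
        by rewrite ger0_norm ?expR_ge0// expR_le1 oppr_le0 mulr_ge0.
    under eq_integral do rewrite mulrBl EFinB.
    rewrite integralB//; [|exact: ie..].
    have := h12 s s0; rewrite /Rintegral => e12.
    (* Both integrals are finite, so the equality of their real values lifts to the extended
       reals. *)
    rewrite -[X in (X - _)%E]fineK; last exact: integrable_fin_num (ie _ i1).
    rewrite -[X in (_ - X)%E]fineK; last exact: integrable_fin_num (ie _ i2).
    by rewrite e12 -EFinB subrr.
apply: filterS; first exact: (ae_filter_ringOfSetsType mu).
by move=> t /eqP; rewrite subr_eq0 => /eqP.
Qed.

Lemma cexp_real (x : R) : cexp x%:C = (expR x)%:C.
Proof. by rewrite /cexp/= cos0 sin0 complexr0 mulr1. Qed.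

(** At real [s] the factor [exp(- s t)] is real, so real and imaginary parts of the transform are
    the transforms of those of the kernel, and the real case applies to each. *)
Lemma laplace_unique (f1 f2 : R -> R[i]) : L1_halfline f1 -> L1_halfline f2 ->
  (forall s, 0 <= complex.Re s -> laplace f1 s = laplace f2 s) ->
  {ae mu, forall t, f1 t = f2 t}.
Proof.
move=> [f10 [r1 i1]] [f20 [r2 i2]] f12.
have exE (f : R -> R[i]) s (t : R) : f t * cexp (- (s%:C * t%:C)) =
    f t * (expR (- (s * t)))%:C.
  by rewrite -rmorphM -rmorphN cexp_real.
have Lr (f : R -> R[i]) s : complex.Re (laplace f s%:C) =
    \int[mu]_(t in `[0, +oo[) (complex.Re (f t) * expR (- (s * t))).
  by rewrite /laplace/=; under eq_Rintegral do rewrite exE cReZ.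
have Li (f : R -> R[i]) s : complex.Im (laplace f s%:C) =
    \int[mu]_(t in `[0, +oo[) (complex.Im (f t) * expR (- (s * t))).
  by rewrite /laplace/=; under eq_Rintegral do rewrite exE cImZ.
have ar : {ae mu, forall t, complex.Re (f1 t) = complex.Re (f2 t)}.
  apply: real_laplace_unique => //.
  - by move=> t /f10 ->.
  - by move=> t /f20 ->.
  - by move=> s s0; rewrite -!Lr f12.
have ai : {ae mu, forall t, complex.Im (f1 t) = complex.Im (f2 t)}.
  apply: real_laplace_unique => //.
  - by move=> t /f10 ->.
  - by move=> t /f20 ->.
  - by move=> s s0; rewrite -!Li f12.
move: ar ai; apply: filterS2; first exact: (ae_filter_ringOfSetsType mu).
by move=> t; exact: eq_complexP.
Qed.

End laplace_unique.

(** * Closure properties of exponential-polynomial kernels *)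

Section exp_kernels.
Context {R : realType}.
Implicit Types (S : set R[i]) (a b : R) (f : R -> R[i]).

(* Lists of terms (coefficient, power, exponent) add by concatenation, unlike
   the rectangular coefficient arrays of [exp_poly]. *)
Definition exp_sum (l : seq (R[i] * nat * R[i])) (t : R) : R[i] :=
  \sum_(x <- l) x.1.1 * t%:C ^+ x.1.2 * cexp (x.2 * t%:C).

Lemma exp_poly_sum m n (c : 'I_m -> 'I_n -> R[i]) (lambda : 'I_m -> R[i]) t :
  exp_poly c lambda t =
  exp_sum [seq (c i j, j : nat, lambda i) | i <- enum 'I_m, j <- enum 'I_n] t.
Proof.
rewrite /exp_sum big_allpairs_dep /exp_poly big_enum; apply: eq_bigr => i _.
by rewrite big_enum.
Qed.

(** Each term of the list gets its own row, with a single nonzero entry in the column of its power;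
    the number of columns is one more than the largest power. *)
Lemma exp_sum_poly S (l : seq (R[i] * nat * R[i])) : {in l, forall x, S x.2} ->
  exists m n (c : 'I_m -> 'I_n -> R[i]) (lambda : 'I_m -> R[i]),
    (forall i, S (lambda i)) /\ forall t, exp_poly c lambda t = exp_sum l t.
Proof.
move=> Sl; pose x i := nth (0, 0%N, 0) l i.
pose n := (\max_(y <- l) y.1.2).+1.
exists (size l), n, (fun i j => if j == (x i).1.2 :> nat then (x i).1.1 else 0).
exists (fun i => (x i).2); split=> [i|t]; first by apply: Sl; exact: mem_nth.
rewrite /exp_sum (big_nth (0, 0%N, 0)) big_mkord; apply: eq_bigr => i _.
have xn : ((x i).1.2 < n)%N.
  by rewrite ltnS (leq_bigmax_seq (F :=
    fun y : R[i] * nat * R[i] => y.1.2))// mem_nth.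
rewrite (bigD1 (Ordinal xn))//= eqxx big1 ?addr0// => j jx.
by rewrite ifF ?mul0r//; apply/negbTE.
Qed.

Lemma exp_kernelsP S a b f : exp_kernels S a b f <->
  (forall t, t \notin `[a, b] -> f t = 0) /\
  exists2 l, {in l, forall x, S x.2} & forall t, t \in `[a, b] ->
    f t = exp_sum l t.
Proof.
split=> [[f0 [m [n [c [lambda [Sl fE]]]]]]|[f0 [l Sl fE]]]; split => //.
  exists [seq (c i j, j : nat, lambda i) | i <- enum 'I_m, j <- enum 'I_n].
    by move=> x /allpairsP[[i j] [_ _ ->]]; exact: Sl.
  by move=> t /fE ->; exact: exp_poly_sum.
have [m [n [c [lambda [Sl' lE]]]]] := exp_sum_poly _ _ Sl.
by exists m, n, c, lambda; split => // t /fE ->.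
Qed.

Lemma exp_kernels0 S a b : exp_kernels S a b (fun=> 0).
Proof. by apply/exp_kernelsP; split => //; exists [::] => // t _;
  rewrite /exp_sum big_nil. Qed.

Lemma exp_kernelsD S a b f g : exp_kernels S a b f -> exp_kernels S a b g ->
  exp_kernels S a b (fun t => f t + g t).
Proof.
move=> /exp_kernelsP[f0 [lf Sf fE]] /exp_kernelsP[g0 [lg Sg gE]].
apply/exp_kernelsP; split; first by move=> t tab; rewrite f0// g0// addr0.
exists (lf ++ lg) => [x|t tab]; last by rewrite /exp_sum big_cat fE// gE.
by rewrite mem_cat => /orP[/Sf|/Sg].
Qed.

Lemma exp_kernelsZ S a b c f : exp_kernels S a b f ->
  exp_kernels S a b (fun t => c * f t).
Proof.
move=> /exp_kernelsP[f0 [l Sl fE]].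
apply/exp_kernelsP; split; first by move=> t tab; rewrite f0// mulr0.
exists [seq (c * x.1.1, x.1.2, x.2) | x <- l].
  by move=> _ /mapP[x xl ->]; exact: Sl xl.
move=> t tab; rewrite fE// /exp_sum big_map mulr_sumr.
by apply: eq_bigr => x _; rewrite /= !mulrA.
Qed.

(** Powers of [t] rise by one and the exponents are unchanged, so the constraint [S], in particular
    stability, is preserved. *)
Lemma exp_kernels_mulN S a b f : exp_kernels S a b f ->
  exp_kernels S a b (fun t => - t%:C * f t).
Proof.
move=> /exp_kernelsP[f0 [l Sl fE]].
apply/exp_kernelsP; split; first by move=> t tab; rewrite f0// mulr0.
exists [seq (- x.1.1, x.1.2.+1, x.2) | x <- l].
  by move=> _ /mapP[x xl ->]; exact: Sl xl.
move=> t tab; rewrite fE// /exp_sum big_map mulr_sumr.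
by apply: eq_bigr => x _; rewrite /= exprS; ring.
Qed.

Lemma exp_kernels_mulXN S a b f k : exp_kernels S a b f ->
  exp_kernels S a b (fun t => (- t%:C) ^+ k * f t).
Proof.
move=> Sf; elim: k => [|k IH].
  by under eq_fun do rewrite expr0 mul1r.
by under eq_fun do rewrite exprS -mulrA; exact: exp_kernels_mulN.
Qed.

Lemma exp_kernels_sum S a b I (r : seq I) (F : I -> R -> R[i]) :
  (forall i, exp_kernels S a b (F i)) ->
  exp_kernels S a b (fun t => \sum_(i <- r) F i t).
Proof.
move=> SF; elim: r => [|i r IH].
  by under eq_fun do rewrite big_nil; exact: exp_kernels0.
by under eq_fun do rewrite big_cons; exact: exp_kernelsD.
Qed.

Lemma loc_bounded_exp_poly m n (c : 'I_m -> 'I_n -> R[i]) (lambda : 'I_m ->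
  R[i]) :
  loc_bounded (exp_poly c lambda).
Proof.
apply: loc_bounded_sum => i; apply: loc_bounded_sum => j.
apply: loc_boundedM; last exact: loc_bounded_cexp.
apply: loc_boundedM; first exact: loc_bounded_cst.
by apply: loc_boundedX; exact: loc_bounded_id.
Qed.

Lemma exp_kernels_bounded S T f : exp_kernels S 0 T f -> bounded_kernel T f.
Proof.
move=> [f0 [m [n [c [lambda [_ fE]]]]]].
have -> : f = (fun t => if t \in `[0, T] then exp_poly c lambda t else 0).
  by apply/funext => t; case: ifPn => [/fE|/f0].
by apply: bounded_kernel_if; exact: loc_bounded_exp_poly.
Qed.

End exp_kernels.

(** * Estimates in L^1 *)

Section L1_norm.
Context {R : realType}.
Notation mu := (@lebesgue_measure R).
Implicit Types f g : R -> R[i].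

(** This is [normA (of_kernel f)], whose atomic sum is zero. *)
Definition L1norm f : \bar R := (\int[mu]_(t in setT) (modulus (f t))%:E)%E.

Let measurable_EFin_modulus f : cmeasurable f ->
  measurable_fun setT (fun t => (modulus (f t))%:E).
Proof. by move=> mf; apply/measurable_EFinP; exact: measurable_modulus. Qed.

Lemma L1norm_translate f (a : R) : cmeasurable f ->
  L1norm (fun t => f (t - a)) = L1norm f.
Proof.
move=> mf; apply: (ge0_integral_translate a (fun t => (modulus (f t))%:E)).
  exact: measurable_EFin_modulus.
by move=> t; rewrite lee_fin modulus_ge0.
Qed.

Lemma L1norm_le_scale f g (c B : R) : cmeasurable f -> cmeasurable g ->
  0 <= c ->
  (forall t, modulus (f t) <= c * modulus (g t)) ->
  (L1norm g <= B%:E)%E -> (L1norm f <= (c * B)%:E)%E.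
Proof.
move=> mf mg c0 fg gB.
have mg' := measurable_EFin_modulus _ mg.
rewrite EFinM (@le_trans _ _ (c%:E * L1norm g)%E)//; last first.
  by rewrite lee_wpmul2l// lee_fin.
rewrite /L1norm -ge0_integralZl//; last first.
  by move=> t _; rewrite lee_fin modulus_ge0.
apply: ge0_le_integral => //.
- by move=> t _; rewrite lee_fin modulus_ge0.
- exact: measurable_EFin_modulus.
- exact: measurable_funeM.
- by move=> t _; rewrite -EFinM lee_fin.
Qed.

Lemma L1norm_le_sum I (r : seq I) (F : I -> R -> R[i]) (B : I -> R) :
  (forall i, cmeasurable (F i)) -> (forall i, L1norm (F i) <= (B i)%:E)%E ->
  (L1norm (fun t => \sum_(i <- r) F i t)%R <= (\sum_(i <- r) B i)%:E)%E.
Proof.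
move=> mF FB; elim: r => [|i r IH].
  rewrite big_nil /L1norm integral0_eq// => t _.
  by rewrite big_nil modulus0.
have mr : cmeasurable (fun t => \sum_(i <- r) F i t) by exact: cmeasurable_sum.
rewrite big_cons EFinD; apply: le_trans (leeD (FB i) IH).
rewrite /L1norm -ge0_integralD//; last 4 first.
- by move=> t _; rewrite lee_fin modulus_ge0.
- exact: measurable_EFin_modulus.
- by move=> t _; rewrite lee_fin modulus_ge0.
- exact: measurable_EFin_modulus.
apply: ge0_le_integral => //.
- by move=> t _; rewrite lee_fin modulus_ge0.
- under eq_fun do rewrite big_cons.
  by apply: measurable_EFin_modulus; exact: cmeasurableD.
- by apply: emeasurable_funD; exact: measurable_EFin_modulus.
- by move=> t _; rewrite big_cons -EFinD lee_fin modulusD.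
Qed.

End L1_norm.

(** * The explicit kernel of a delay combination *)

Section delay_kernel.
Context {R : realType} (vartheta : R) (m K : nat) (G : 'I_m -> 'I_K ->
  {poly R[i]}).
Hypothesis vartheta0 : 0 < vartheta.
Implicit Types F : 'I_m -> R -> R[i].

(** The kernel whose transform multiplies [exp(- n vartheta s)], before translation. *)
Definition delay_term F (n : nat) (t : R) : R[i] :=
  \sum_(i < m) \sum_(k < K) (G i k)`_n * ((- t%:C) ^+ k * F i t).

(** [N] is a degree bound for the polynomials, kept as a parameter so that [N = 0] yields a kernel
    without translates. *)
Definition delay_kernel N F (t : R) : R[i] :=
  \sum_(n < N.+1) delay_term F n (t - n%:R * vartheta).

Lemma loc_bounded_mulXN k : loc_bounded (fun t : R => (- t%:C) ^+ k).
Proof. by apply: loc_boundedX; exact: loc_boundedN (@loc_bounded_id R). Qed.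

(** Linearity turns [g - g_app] into the kernel built from the differences [theta - psi]. *)
Lemma delay_kernelB N F1 F2 t :
  delay_kernel N (fun i u => F1 i u - F2 i u) t =
  delay_kernel N F1 t - delay_kernel N F2 t.
Proof.
rewrite /delay_kernel /delay_term -sumrB; apply: eq_bigr => n _.
rewrite -sumrB; apply: eq_bigr => i _; rewrite -sumrB; apply: eq_bigr => k _.
by rewrite !mulrBr.
Qed.

Lemma bounded_kernel_delay_term F n : (forall i, bounded_kernel vartheta (F
  i)) ->
  bounded_kernel vartheta (delay_term F n).
Proof.
move=> FT; apply: bounded_kernel_sum => i; apply: bounded_kernel_sum => k.
apply: bounded_kernelM; last exact: loc_bounded_cst.
by apply: bounded_kernelM => //; exact: loc_bounded_mulXN.
Qed.

Lemma exp_kernels_delay_term S F n : (forall i, exp_kernels S 0 vartheta (F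
  i)) ->
  exp_kernels S 0 vartheta (delay_term F n).
Proof.
move=> SF; apply: exp_kernels_sum => i; apply: exp_kernels_sum => k.
by apply: exp_kernelsZ; exact: exp_kernels_mulXN.
Qed.

Let bounded_kernel_delay_shift N F (n : 'I_N.+1) :
  (forall i, bounded_kernel vartheta (F i)) ->
  bounded_kernel (N.+1%:R * vartheta)
    (fun t => delay_term F n (t - n%:R * vartheta)).
Proof.
move=> FT; apply: (bounded_kernel_shift vartheta).
- by rewrite mulr_ge0// ltW.
(* As [n <= N], the translated support ends at [(n + 1) vartheta <= (N + 1) vartheta]. *)
- by rewrite -{1}[vartheta]mul1r -mulrDl ler_pM2r// nat1r ler_nat ltnS -ltnS.
- exact: bounded_kernel_delay_term.
Qed.

Lemma bounded_kernel_delay_kernel N F : (forall i, bounded_kernel vartheta (F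
  i)) ->
  bounded_kernel (N.+1%:R * vartheta) (delay_kernel N F).
Proof.
by move=> FT; apply: bounded_kernel_sum => n; exact: bounded_kernel_delay_shift.
Qed.

Lemma laplace_delay_term F n s : (forall i, bounded_kernel vartheta (F i)) ->
  laplace (delay_term F n) s =
  \sum_(i < m) \sum_(k < K) (G i k)`_n * cderiven k (laplace (F i)) s.
Proof.
move=> FT.
have kT i (k : 'I_K) : bounded_kernel vartheta (fun t => (- t%:C) ^+ k * F i t).
  by apply: bounded_kernelM => //; exact: loc_bounded_mulXN.
have cT i (k : 'I_K) : bounded_kernel vartheta
    (fun t => (G i k)`_n * ((- t%:C) ^+ k * F i t)).
  by apply: bounded_kernelM => //; exact: loc_bounded_cst.
rewrite (laplace_sum vartheta); last by move=> i; exact: bounded_kernel_sum.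
apply: eq_bigr => i _; rewrite (laplace_sum vartheta)//.
apply: eq_bigr => k _; rewrite (laplaceZ vartheta)//.
by rewrite (cderiven_laplace vartheta)// ltW.
Qed.

Lemma laplace_delay_kernel N F s : (forall i, bounded_kernel vartheta (F i)) ->
  (forall i k, (size (G i k) <= N.+1)%N) ->
  laplace (delay_kernel N F) s =
  delay_combination vartheta G (fun i => laplace (F i)) s.
Proof.
move=> FT sG; rewrite (laplace_sum (N.+1%:R * vartheta)); last first.
  by move=> n; exact: bounded_kernel_delay_shift.
rewrite /delay_combination.
under eq_bigr => n _.
  rewrite (laplace_translate vartheta); last 2 first.
  - by rewrite mulr_ge0// ltW.
  - exact: bounded_kernel_delay_term.
  rewrite laplace_delay_term// mulr_sumr.
  under eq_bigr do rewrite mulr_sumr.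
  over.
(* The sum over translates is moved innermost, where it is the expansion of [G i k] at
   [exp(- vartheta s)]. *)
rewrite exchange_big; apply: eq_bigr => i _.
rewrite exchange_big; apply: eq_bigr => k _.
rewrite (horner_coef_wide _ (sG i k)) mulr_suml; apply: eq_bigr => n _.
rewrite cexpX mulrCA mulrA; congr (_ * cexp _ * _).
by rewrite rmorphM/= rmorph_nat; ring.
Qed.

Lemma has_laplace_delay_kernel N F : (forall i, bounded_kernel vartheta (F i))
  ->
  (forall i k, (size (G i k) <= N.+1)%N) ->
  has_laplace (delay_kernel N F)
    (delay_combination vartheta G (fun i => laplace (F i))).
Proof.
move=> FT sG; split=> [|s _]; last exact: laplace_delay_kernel.
by apply: bounded_kernel_L1; exact: bounded_kernel_delay_kernel.
Qed.

(** It involves only [vartheta] and the coefficients of [G], so it can be fixed before the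
    tolerances and the approximants. *)
Definition delay_constant N : R := \sum_(n < N.+1) \sum_(i < m) \sum_(k < K)
  modulus ((G i k)`_n) * vartheta ^+ k.

Lemma delay_constant_ge0 N : 0 <= delay_constant N.
Proof.
do 3 apply: sumr_ge0 => ? _.
by rewrite mulr_ge0 ?modulus_ge0// exprn_ge0// ltW.
Qed.

(** Translation preserves the L^1 norm, and [|(- t)^k| <= vartheta^k] on the support of [F i]. *)
Lemma L1norm_delay_kernel_le N F (B : R) : (forall i, bounded_kernel vartheta
  (F i)) ->
  (forall i, L1norm (F i) <= B%:E)%E ->
  (L1norm (delay_kernel N F) <= (delay_constant N * B)%:E)%E.
Proof.
move=> FT FB; rewrite /delay_constant mulr_suml; apply: L1norm_le_sum => n.
  by have [] := bounded_kernel_delay_shift N F n FT.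
have mk i (k : 'I_K) : cmeasurable
  (fun t => (G i k)`_n * ((- t%:C) ^+ k * F i t)).
  apply: cmeasurableM; first exact: cmeasurable_cst.
  have [mF _ _] := FT i; apply: cmeasurableM => //.
  by have [] := loc_bounded_mulXN k.
rewrite L1norm_translate; last by have [] := bounded_kernel_delay_term F n FT.
rewrite mulr_suml; apply: L1norm_le_sum => i; first exact: cmeasurable_sum.
rewrite mulr_suml; apply: L1norm_le_sum => k //.
have [mF F0 _] := FT i.
apply: (L1norm_le_scale _ (F i)) => //.
  by rewrite mulr_ge0 ?modulus_ge0// exprn_ge0// ltW.
move=> t; rewrite !modulusM -mulrA ler_wpM2l ?modulus_ge0//.
have [|/F0 ->] := boolP (t \in `[0, vartheta]); last by rewrite modulus0 !mulr0.
rewrite in_itv/= => /andP[t0 tv]; rewrite ler_wpM2r ?modulus_ge0//.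
rewrite modulusX modulusN modulus_real ger0_norm// lerXn2r ?nnegrE//.
exact: ltW.
Qed.

End delay_kernel.

(** * Stable approximation of a distributed delay *)

(** A transform determines its kernel up to a null set, so the conclusions concern every [g_app]
    with the given transform, and existence is stated separately. Polynomials of degree at most [N]
    translate by up to [N vartheta]; constant ones leave the support in [[0, vartheta]]. *)
Theorem theorem3 (R : realType) (vartheta : R) (m n : nat)
    (lambda : 'I_m -> R[i]) (G : 'I_m -> 'I_n -> {poly R[i]})
    (g : R -> R[i]) :
  0 < vartheta ->
  distributed_delays g ->
  has_laplace g
    (delay_combination vartheta G (fun i => laplace (theta vartheta (lambda i)))) ->
  exists2 M : R, 0 < M &
  forall (epsilon : 'I_m -> R) (psi : 'I_m -> R -> R[i]),
    (forall i, 0 < epsilon i) ->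
    (forall i, stable_kernels 0 vartheta (psi i)) ->
    (forall i, ballA (of_kernel (theta vartheta (lambda i))) (epsilon i)
                     (of_kernel (psi i))) ->
    let ghat_app := delay_combination vartheta G (fun i => laplace (psi i)) in
    (exists g_app : R -> R[i], has_laplace g_app ghat_app) /\
    forall g_app : R -> R[i], has_laplace g_app ghat_app ->
      [/\ ballA (of_kernel g) (M * \big[Num.max/0]_(i < m) epsilon i)
                (of_kernel g_app),
          (forall N : nat, (forall i k, (size (G i k) <= N.+1)%N) ->
            ae_member (delayed_stable_kernels vartheta N) g_app) &
          ((forall i k, (size (G i k) <= 1)%N) ->
            ae_member (stable_kernels 0 vartheta) g_app)].
Proof.
move=> v0 _ gL.
(* A degree bound common to all the polynomials. *)
pose N0 := \max_(i < m) \max_(k < n) size (G i k).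
have sG i k : (size (G i k) <= N0.+1)%N.
  apply: leqW; apply: leq_trans (@leq_bigmax _ (fun k => size (G i k)) k) _.
  exact: (@leq_bigmax _ (fun i => \max_(k < n) size (G i k)) i).
have thetaT i : bounded_kernel vartheta (theta vartheta (lambda i)).
  exact: bounded_kernel_if (loc_bounded_cexp (lambda i)).
have C0 := delay_constant_ge0 vartheta m n G v0 N0.
(* The summand 1 keeps [M] positive when the constant is zero. *)
exists (1 + delay_constant vartheta m n G N0); first by rewrite ltr_wpDr.
move=> epsilon psi eps0 psiS psiB ghat_app.
have psiT i : bounded_kernel vartheta (psi i)
  by exact: exp_kernels_bounded (psiS i).
split; first by exists (delay_kernel vartheta m n G N0 psi);
  exact: has_laplace_delay_kernel.
move=> h hL.
(* Injectivity identifies any kernel of the transform with the explicit one. [N] stays free: the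
   norm bound uses [N0], the membership claims any admissible [N]. *)
have aeE N f F F' : (forall i, bounded_kernel vartheta (F i)) ->
    (forall i k, (size (G i k) <= N.+1)%N) ->
    F' = (fun i => laplace (F i)) ->
    has_laplace f (delay_combination vartheta G F') ->
    {ae lebesgue_measure, forall t, f t = delay_kernel vartheta m n G N F t}.
  move=> FT sGN -> [fL1 fE].
  have [dL1 dE] := has_laplace_delay_kernel vartheta m n G v0 N F FT sGN.
  by apply: laplace_unique => // s s0; rewrite fE// dE.
split; last 2 first.
- move=> N sGN; exists (delay_kernel vartheta m n G N psi); last exact: aeE hL.
  exists (delay_term m n G psi); split => // j.
  exact: exp_kernels_delay_term.
(* For constant polynomials only the untranslated term remains. *)
- move=> sG1; exists (delay_kernel vartheta m n G 0 psi); last exact: aeE hL.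
  have -> : delay_kernel vartheta m n G 0 psi = delay_term m n G psi 0.
    by apply/funext => t; rewrite /delay_kernel big_ord1 mul0r subr0.
  exact: exp_kernels_delay_term.
have esum0 (f : R -> R[i]) : (forall t, f t = 0) ->
    (\esum_(t in setT) (modulus (f t))%:E = 0)%E.
  by move=> f0; apply: esum1 => t _; rewrite f0 modulus0.
split.
  have [hL1 _] := hL; split => //.
  (* There are no atoms, so any increasing sequence starting at 0 serves. *)
  - exists (fun k => k%:R); split => //.
    by move=> k; rewrite ltr_nat.
  - by rewrite /= esum0 ?ltry.
rewrite /normA/= esum0 ?adde0; last by move=> t; rewrite subrr.
pose D i t := theta vartheta (lambda i) t - psi i t.
have DT i : bounded_kernel vartheta (D i).
  apply: bounded_kernelD => //; under eq_fun do rewrite -mulN1r.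
  by apply: bounded_kernelM => //; exact: loc_bounded_cst.
have DL i : (L1norm (D i) <= (\big[Num.max/0]_(i < m) epsilon i)%:E)%E.
  have [_] := psiB i; rewrite /normA/= esum0 ?adde0; last by move=> t;
    rewrite subrr.
  move=> /le_trans; apply; rewrite lee_fin; exact: le_bigmax.
have [mD _ _] := bounded_kernel_delay_kernel vartheta m n G v0 N0 D DT.
(* Almost everywhere, [g - h] is the explicit kernel of the differences [D]. *)
have -> : (\int[lebesgue_measure]_t (modulus (g t - h t))%:E =
    L1norm (delay_kernel vartheta m n G N0 D))%E.
  apply: ae_eq_integral => //.
  - have [[_ gi] _] := gL; have [[_ hi] _] := hL.
    apply/measurable_EFinP; apply: measurable_modulus.
    by apply: cmeasurableD; [|apply: cmeasurableN];
      exact: cintegrable_measurable.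
  - by apply/measurable_EFinP; exact: measurable_modulus.
  - have ag := aeE N0 g _ _ thetaT sG erefl gL.
    have ah := aeE N0 h _ _ psiT sG erefl hL.
    move: ag ah; apply: filterS2;
      first exact: (ae_filter_ringOfSetsType lebesgue_measure).
    by move=> t -> -> _; rewrite -delay_kernelB.
apply: le_trans (L1norm_delay_kernel_le vartheta m n G v0 N0 D _ DT DL) _.
(* The maximum is nonnegative because it starts from 0, so enlarging the constant by 1 preserves the
   bound. *)
rewrite lee_fin ler_wpM2r ?lerDr//.
exact: bigmax_ge_id.
Qed.
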